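(* $Z + SD \vdash AC_{\aleph_0}^{fin}$. That is, in Zermelo set theory $Z$ together with the statement $SD$ (''every Standard Infinite set is Dedekind Infinite''), it is provable that for every countable family $\{X_n\}_{n \in \mathbb{N}}$ of nonempty finite sets there exists a choice function, i.e. a function $f : \mathbb{N} \to \bigcup_{n \in \mathbb{N}} X_n$ with $f(n) \in X_n$ for all $n \in \mathbb{N}$ (equivalently, $\prod_{n \in \mathbb{N}} X_n \neq \emptyset$).
   Context: The system $Z$ is the first-order theory with equality and one binary predicate $\in$ (all objects are sets, no atoms), with the axioms: Extensionality; Null Set (existence of $\emptyset$); Pair Set; Union Set; Infinity (there is an inductive set: a set containing $\emptyset$ and closed under $a \mapsto a \cup \{a\}$); Power Set; and the axiom schema of restricted Comprehension (for every set $a$ and every formula $\varphi(x,u_1,\dots,u_n)$ with parameters $u_i$, the set $\{x \in a : \varphi(x,u_1,\dots,u_n)\}$ exists). The axioms of Replacement, Foundation and Choice are not included in $Z$. Here $\mathbb{N} = \omega$ is the least inductive set; its elements are the natural numbers, and $n = \{0,\dots,n-1\}$. Two sets are equipotent if there is a bijection between them. A set is finite if it is equipotent to some $n \in \omega$. A set is Standard Infinite if it is not finite. A set $X$ is Dedekind Infinite if it contains a proper subset $B \subset X$ equipotent to $X$. $SD$ is the statement: if a set is Standard Infinite, then it is also Dedekind Infinite. $AC_{\aleph_0}^{fin}$ is the Axiom of Countable Choice on Finite Sets, i.e. the statement that every countable family $\{X_n\}_{n\in\mathbb{N}}$ (a function $n \mapsto X_n$ with domain $\mathbb{N}$) of nonempty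 finite sets has a choice function. $T \vdash \psi$ means that $\psi$ is provable from $T$. *)

(* Defs.v *)
From Stdlib Require Import List.
Import ListNotations.

(** * Classical first-order logic with equality over one binary predicate

    The signature has no function symbols, so the only terms are variables,
    which are de Bruijn indices. *)

Inductive form : Type :=
| Mem : nat -> nat -> form
| Eqn : nat -> nat -> form
| Bot : form
| Imp : form -> form -> form
| All : form -> form.

Definition Neg (p : form) : form := Imp p Bot.
Definition And (p q : form) : form := Neg (Imp p (Neg q)).
Definition Or (p q : form) : form := Imp (Neg p) q.
Definition Iff (p q : form) : form := And (Imp p q) (Imp q p).
Definition Ex (p : form) : form := Neg (All (Neg p)).

Declare Scope form_scope.
Delimit Scope form_scope with form.
Bind Scope form_scope with form.
Notation "x ∈ y" := (Mem x y) (at level 70, no associativity) : form_scope.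
Notation "x ≐ y" := (Eqn x y) (at level 70, no associativity) : form_scope.
Notation "¬ p" := (Neg p) (at level 75, right associativity) : form_scope.
Notation "p ∧ q" := (And p q) (at level 80, right associativity) : form_scope.
Notation "p ∨ q" := (Or p q) (at level 85, right associativity) : form_scope.
Notation "p ⇒ q" := (Imp p q) (at level 90, right associativity) : form_scope.
Notation "p ⇔ q" := (Iff p q) (at level 95, no associativity) : form_scope.
Notation "∀ p" := (All p) (at level 75, right associativity) : form_scope.
Notation "∃ p" := (Ex p) (at level 75, right associativity) : form_scope.
Local Open Scope form_scope.

Definition up (r : nat -> nat) (k : nat) : nat :=
  match k with 0 => 0 | S k => S (r k) end.

Fixpoint rename (r : nat -> nat) (p : form) : form :=
  match p with
  | Mem x y => Mem (r x) (r y)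
  | Eqn x y => Eqn (r x) (r y)
  | Bot => Bot
  | Imp p q => Imp (rename r p) (rename r q)
  | All p => All (rename (up r) p)
  end.

Definition shift (p : form) : form := rename S p.

(** [inst t p] is the body [p] of a quantifier with its bound variable replaced
    by the variable [t]. *)
Definition inst (t : nat) (p : form) : form :=
  rename (fun k => match k with 0 => t | S k => k end) p.

(** All free variables of [p] are smaller than [n]. *)
Fixpoint bounded (n : nat) (p : form) : Prop :=
  match p with
  | Mem x y => x < n /\ y < n
  | Eqn x y => x < n /\ y < n
  | Bot => True
  | Imp p q => bounded n p /\ bounded n q
  | All p => bounded (S n) p
  end.

Fixpoint alls (n : nat) (p : form) : form :=
  match n with 0 => p | S n => All (alls n p) end.

(** Natural deduction. In [AllI] the eigenvariable is index 0, which is fresh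
    for the shifted hypotheses. *)
Inductive derives : list form -> form -> Prop :=
| Hyp G p : In p G -> derives G p
| ImpI G p q : derives (p :: G) q -> derives G (p ⇒ q)
| ImpE G p q : derives G (p ⇒ q) -> derives G p -> derives G q
| AllI G p : derives (map shift G) p -> derives G (∀ p)
| AllE G p t : derives G (∀ p) -> derives G (inst t p)
| Raa G p : derives ((¬ p) :: G) Bot -> derives G p
| EqI G x : derives G (x ≐ x)
| EqE G p x y : derives G (x ≐ y) -> derives G (inst x p) -> derives G (inst y p).

Definition theory : Type := form -> Prop.

Definition extend (T : theory) (s : form) : theory := fun p => T p \/ p = s.

Definition provable (T : theory) (p : form) : Prop :=
  exists G : list form, (forall q, In q G -> T q) /\ derives G p.

Notation "T ⊢ p" := (provable T p%form) (at level 99, no associativity).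

(** * Set-theoretic notions

    The arguments [x], [y], ... of the following definitions are variables.
    Under [k] additional quantifiers the variable [x] is written [k + x]. *)

Definition is_empty (x : nat) : form := ∀ (¬ (0 ∈ 1 + x)).

Definition subset (x y : nat) : form := ∀ (0 ∈ 1 + x ⇒ 0 ∈ 1 + y).

(** [z = {x, y}] *)
Definition is_pair (z x y : nat) : form :=
  ∀ (0 ∈ 1 + z ⇔ (0 ≐ 1 + x ∨ 0 ≐ 1 + y)).

(** [z] is the union of [x]. *)
Definition is_union (z x : nat) : form :=
  ∀ (0 ∈ 1 + z ⇔ ∃ (0 ∈ 2 + x ∧ 1 ∈ 0)).

(** [z] is the power set of [x]. *)
Definition is_power (z x : nat) : form :=
  ∀ (0 ∈ 1 + z ⇔ subset 0 (1 + x)).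

(** [y = x ∪ {x}] *)
Definition is_succ (y x : nat) : form :=
  ∀ (0 ∈ 1 + y ⇔ (0 ∈ 1 + x ∨ 0 ≐ 1 + x)).

Definition inductive_set (x : nat) : form :=
  ∃ (is_empty 0 ∧ 0 ∈ 1 + x) ∧
  ∀ (0 ∈ 1 + x ⇒ ∃ (is_succ 0 1 ∧ 0 ∈ 2 + x)).

Definition is_omega (x : nat) : form :=
  inductive_set x ∧ ∀ (inductive_set 0 ⇒ subset (1 + x) 0).

(** Kuratowski pairs: [z = {{x}, {x, y}}] *)
Definition is_opair (z x y : nat) : form :=
  ∀ (0 ∈ 1 + z ⇔ (is_pair 0 (1 + x) (1 + x) ∨ is_pair 0 (1 + x) (1 + y))).

(** [(x, y) ∈ f] *)
Definition maps (f x y : nat) : form :=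
  ∃ (is_opair 0 (1 + x) (1 + y) ∧ 0 ∈ 1 + f).

(** [f] is a function with domain [a]. *)
Definition function_on (f a : nat) : form :=
  ∀ (0 ∈ 1 + f ⇒ ∃ ∃ (1 ∈ 3 + a ∧ is_opair 2 1 0)) ∧
  ∀ (0 ∈ 1 + a ⇒ ∃ (maps (2 + f) 1 0)) ∧
  ∀ ∀ ∀ (maps (3 + f) 2 1 ⇒ maps (3 + f) 2 0 ⇒ 1 ≐ 0).

(** [f : a -> b] *)
Definition function (f a b : nat) : form :=
  function_on f a ∧ ∀ ∀ (maps (2 + f) 1 0 ⇒ 0 ∈ 2 + b).

Definition bijection (f a b : nat) : form :=
  function f a b ∧
  ∀ ∀ ∀ (maps (3 + f) 2 0 ⇒ maps (3 + f) 1 0 ⇒ 2 ≐ 1) ∧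
  ∀ (0 ∈ 1 + b ⇒ ∃ (maps (2 + f) 0 1)).

Definition equipotent (a b : nat) : form := ∃ (bijection 0 (1 + a) (1 + b)).

Definition is_natural (n : nat) : form := ∃ (is_omega 0 ∧ 1 + n ∈ 0).

Definition finite (a : nat) : form := ∃ (is_natural 0 ∧ equipotent (1 + a) 0).

Definition standard_infinite (a : nat) : form := ¬ finite a.

Definition dedekind_infinite (a : nat) : form :=
  ∃ ((subset 0 (1 + a) ∧ ¬ (0 ≐ 1 + a)) ∧ equipotent 0 (1 + a)).

(** * The theory Z *)

Definition extensionality : form := ∀ ∀ (∀ (0 ∈ 2 ⇔ 0 ∈ 1) ⇒ 1 ≐ 0).
Definition null_set : form := ∃ (is_empty 0).
Definition pair_set : form := ∀ ∀ ∃ (is_pair 0 2 1).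
Definition union_set : form := ∀ ∃ (is_union 0 1).
Definition infinity : form := ∃ (inductive_set 0).
Definition power_set : form := ∀ ∃ (is_power 0 1).

(** In [p] the index 0 stands for [x] and [1], ..., [n] for the parameters
    [u_1], ..., [u_n]. The renaming makes room for the set [a] (index 2) and its
    subset [b] (index 1), neither of which then occurs in [p]; a parameter may
    still be instantiated with the same set as [a]. *)
Definition comprehension (n : nat) (p : form) : form :=
  alls n (∀ ∃ ∀ (0 ∈ 1 ⇔
    (0 ∈ 2 ∧ rename (fun k => match k with 0 => 0 | S k => 3 + k end) p))).

Inductive Z : theory :=
| Z_extensionality : Z extensionality
| Z_null_set : Z null_set
| Z_pair_set : Z pair_set
| Z_union_set : Z union_set
| Z_infinity : Z infinity
| Z_power_set : Z power_set
| Z_comprehension n p : bounded (S n) p -> Z (comprehension n p).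

(** * The principles SD and countable choice for finite sets *)

Definition SD : form := ∀ (standard_infinite 0 ⇒ dedekind_infinite 0).

(** [F] is a function on [w] whose values are nonempty finite sets. *)
Definition family_of_nonempty_finite (F w : nat) : form :=
  function_on F w ∧
  ∀ ∀ (maps (2 + F) 1 0 ⇒ ¬ is_empty 0 ∧ finite 0).

(** [u] is the union of the values of [F]. *)
Definition is_family_union (u F : nat) : form :=
  ∀ (0 ∈ 1 + u ⇔ ∃ ∃ (maps (3 + F) 1 0 ∧ 2 ∈ 0)).

(** [f] maps [w] to the union of the values of [F], and [f(n) ∈ F(n)] for all
    [n ∈ w]. *)
Definition choice_function (f F w : nat) : form :=
  ∃ (is_family_union 0 (1 + F) ∧ function (1 + f) (1 + w) 0) ∧
  ∀ (0 ∈ 1 + w ⇒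
     ∃ ∃ (maps (3 + F) 2 1 ∧ maps (3 + f) 2 0 ∧ 0 ∈ 1)).

Definition AC_countable_fin : form :=
  ∀ (is_omega 0 ⇒
     ∀ (family_of_nonempty_finite 0 1 ⇒ ∃ (choice_function 0 1 2))).

(* Main.v *)
From Stdlib Require Import List Lia Arith Cantor.
From Stdlib Require Import Classical ClassicalEpsilon ProofIrrelevance
  FunctionalExtensionality PropExtensionality.
Require Import Defs.
Import ListNotations.

(** The calculus is complete, so it suffices to prove countable choice for
    finite sets in an arbitrary structure [D], [E] that satisfies Z and SD; the
    set theory is then ordinary mathematics about [D] and [E]
    ([completeness]). What remains of the formal language is that comprehension
    is available for first-order definable properties only. The class [dfn] of
    definable properties is closed under all logical operations, so definability
    can be read off from the shape of a property ([separation]).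

    In the structure, let X be a family of nonempty finite sets indexed by omega,
    and let Y be the set of its partial choices, the choice functions for the
    initial segments {X_i : i < m}. By induction there are partial choices of
    every length m, so Y is not finite: a finite subset of Y has a bound on the
    lengths of its members ([PartialChoice_set_infinite]). By SD there are an
    injection of Y into itself and some y0 outside its image. The orbit O of y0,
    ordered by reachability, is ordered like omega: every nonempty definable
    part of it has a least element and no member of Y is an upper bound
    ([orbit_order]).

    The members of O are not all defined only below a fixed n. Indeed, for every
    i there is a partial choice t of length i that is extended by cofinally many
    members of O ([cofinal_PartialChoice]). For i = 0 take the empty one. If t
    works for i, then all members of O that extend t and differ from it have a
    value at i, which is one of finitely many; since O is ordered like omega, one
    of these values x occurs cofinally often, and t extended by (i, x) works for
    i + 1. This pigeonhole argument ([cofinal_extension]) needs only that each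
    X_i is finite, not that there are finitely many partial choices of length i.

    So for every n some member of O is defined at n, and the first of them in
    the order of O determines f(n) without any choice ([choice_exists]). *)

(** * Renaming of variables and derivations *)

Lemma up_ext r s n :
  (forall k, k < n -> r k = s k) -> forall k, k < S n -> up r k = up s k.
Proof. intros H [|k] Hk; simpl; [easy|]. rewrite H by lia. easy. Qed.

Lemma rename_bounded p : forall n r s, bounded n p ->
  (forall k, k < n -> r k = s k) -> rename r p = rename s p.
Proof.
  induction p; simpl; intros n' r s Hb H.
  - rewrite !H; tauto.
  - rewrite !H; tauto.
  - easy.
  - f_equal; [eapply IHp1 | eapply IHp2]; eauto; tauto.
  - f_equal. eapply IHp; [exact Hb|]. now apply up_ext.
Qed.

Lemma bounded_mono p : forall n m, n <= m -> bounded n p -> bounded m p.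
Proof.
  induction p; simpl; intros n' m Hm Hb; try lia; try easy.
  - destruct Hb. eauto.
  - apply IHp with (S n'); [lia|easy].
Qed.

Lemma bounded_exists p : exists n, bounded n p.
Proof.
  induction p as [x y|x y| |p [n Hn] q [m Hm]|p [n Hn]]; simpl.
  - exists (S (x + y)). lia.
  - exists (S (x + y)). lia.
  - now exists 0.
  - exists (n + m). split; eapply bounded_mono; [|exact Hn| |exact Hm]; lia.
  - exists n. apply bounded_mono with n; [lia|easy].
Qed.

Lemma bounded_rename p : forall n m r, bounded n p ->
  (forall k, k < n -> r k < m) -> bounded m (rename r p).
Proof.
  induction p; simpl; intros n' m r Hb H.
  - destruct Hb; auto.
  - destruct Hb; auto.
  - easy.
  - destruct Hb; eauto.
  - apply IHp with (S n'); [exact Hb|]. intros [|k] Hk; simpl; [lia|].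
  specialize (H k). lia.
Qed.

Lemma rename_ext p r s : (forall k, r k = s k) -> rename r p = rename s p.
Proof.
  intros H. destruct (bounded_exists p) as [n Hn].
  eapply rename_bounded; eauto.
Qed.

Lemma rename_comp p : forall r s,
  rename r (rename s p) = rename (fun k => r (s k)) p.
Proof.
  induction p; simpl; intros r s; try reflexivity.
  - now rewrite IHp1, IHp2.
  - f_equal. rewrite IHp. apply rename_ext. now intros [|k].
Qed.

Lemma rename_id p r : (forall k, r k = k) -> rename r p = p.
Proof.
  revert r. induction p; simpl; intros r H; rewrite ?H; try reflexivity.
  - rewrite IHp1, IHp2; auto.
  - rewrite IHp; auto. intros [|k]; simpl; auto.
Qed.

Lemma rename_closed p r : bounded 0 p -> rename r p = p.
Proof.
  intros H. rewrite <- (rename_id p (fun k => k)) at 2 by easy.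
  eapply rename_bounded; eauto. lia.
Qed.

Lemma rename_inst r t p :
  rename r (inst t p) = inst (r t) (rename (up r) p).
Proof.
  unfold inst. rewrite !rename_comp. apply rename_ext. now intros [|k].
Qed.

Lemma rename_shift r p : rename (up r) (shift p) = shift (rename r p).
Proof. unfold shift. now rewrite !rename_comp. Qed.

Lemma derives_incl G p : derives G p -> forall H, incl G H -> derives H p.
Proof.
  induction 1; intros H' HI.
  - apply Hyp. auto.
  - apply ImpI. apply IHderives. intros x [->|Hx]; simpl; auto.
  - eapply ImpE; eauto.
  - apply AllI. apply IHderives. now apply incl_map.
  - apply AllE. auto.
  - apply Raa. apply IHderives. intros x [->|Hx]; simpl; auto.
  - apply EqI.
  - eapply EqE; eauto.
Qed.

Lemma derives_rename G p : derives G p ->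
  forall r, derives (map (rename r) G) (rename r p).
Proof.
  induction 1; intros r.
  - apply Hyp. now apply in_map.
  - apply ImpI. apply IHderives.
  - eapply ImpE; [apply IHderives1 | apply IHderives2].
  - simpl. apply AllI. specialize (IHderives (up r)).
    rewrite map_map in *. erewrite map_ext; [exact IHderives|].
    intros q. symmetry. apply rename_shift.
  - rewrite rename_inst. apply AllE. apply IHderives.
  - apply Raa. apply IHderives.
  - apply EqI.
  - rewrite rename_inst. eapply EqE; [apply IHderives1|].
    rewrite <- rename_inst. apply IHderives2.
Qed.

(** The eigenvariable rule for a named variable: instead of index 0 above a
    shifted context, any index [c] that is fresh for context and formula may be
    generalized, by the renaming that moves [c] to 0 and makes room for it. *)
Lemma AllI_fresh G p c : (forall q, In q G -> bounded c q) -> bounded (S c) p ->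
  derives G (inst c p) -> derives G (All p).
Proof.
  intros HG Hp Hd. apply AllI.
  set (r := fun k => if k =? c then 0 else S k).
  apply derives_rename with (r := r) in Hd.
  assert (Hr : forall k, k < c -> r k = S k).
  { intros k Hk. unfold r. destruct (Nat.eqb_spec k c); lia. }
  rewrite (map_ext_in _ shift) in Hd.
  2:{ intros q Hq. eapply rename_bounded; [exact (HG q Hq)|]. exact Hr. }
  replace (rename r (inst c p)) with p in Hd; [exact Hd|].
  unfold inst. rewrite rename_comp.
  rewrite <- (rename_id p (fun k => k)) at 1 by easy.
  eapply rename_bounded; [exact Hp|]. intros [|k] Hk.
  - unfold r. now rewrite Nat.eqb_refl.
  - rewrite Hr; lia.
Qed.

(** * Tarski semantics *)

Definition scons {D : Type} (d : D) (e : nat -> D) (k : nat) : D :=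
  match k with 0 => d | S k => e k end.

Fixpoint sat {D : Type} (E : D -> D -> Prop) (e : nat -> D) (p : form) : Prop :=
  match p with
  | Mem x y => E (e x) (e y)
  | Eqn x y => e x = e y
  | Bot => False
  | Imp p q => sat E e p -> sat E e q
  | All p => forall d, sat E (scons d e) p
  end.

Lemma sat_rename D (E : D -> D -> Prop) p : forall e e' r,
  (forall k, e (r k) = e' k) -> (sat E e (rename r p) <-> sat E e' p).
Proof.
  induction p; simpl; intros e e' r H.
  - now rewrite !H.
  - now rewrite !H.
  - easy.
  - now rewrite (IHp1 e e' r), (IHp2 e e' r).
  - split; intros Hs d; eapply IHp; try exact (Hs d); now intros [|k]; simpl.
Qed.

Lemma sat_ext D (E : D -> D -> Prop) p e e' :
  (forall k, e k = e' k) -> (sat E e p <-> sat E e' p).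
Proof.
  intros H. rewrite <- (sat_rename D E p e e' (fun k => k)) by easy.
  now rewrite rename_id.
Qed.

(** * The completeness theorem *)

Fixpoint code (p : form) : nat :=
  match p with
  | Mem x y => to_nat (0, to_nat (x, y))
  | Eqn x y => to_nat (1, to_nat (x, y))
  | Bot => to_nat (2, 0)
  | Imp p q => to_nat (3, to_nat (code p, code q))
  | All p => to_nat (4, code p)
  end.

Lemma to_nat_inj x y : to_nat x = to_nat y -> x = y.
Proof. intros H. now rewrite <- (cancel_of_to x), H, cancel_of_to. Qed.

(** There are only countably many formulas, so that the Henkin construction can
    treat them one at a time, with a finite list of assumptions at every stage. *)
Lemma code_inj p : forall q, code p = code q -> p = q.
Proof.
  induction p; intros [] H; cbn [code] in H;
    apply to_nat_inj, pair_equal_spec in H as [Htag H];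
    try discriminate Htag; try reflexivity.
  - apply to_nat_inj in H. congruence.
  - apply to_nat_inj in H. congruence.
  - apply to_nat_inj, pair_equal_spec in H as [H1 H2]. f_equal; auto.
  - f_equal; auto.
Qed.

Section Henkin.

Variable T : theory.
Hypothesis T_closed : forall q, T q -> bounded 0 q.

Definition proves (G : list form) (p : form) : Prop :=
  exists L, (forall q, In q L -> T q) /\ derives (L ++ G) p.

Definition consistent (G : list form) : Prop := ~ proves G Bot.

Lemma proves_derives G p : derives G p -> proves G p.
Proof. intros H. now exists []. Qed.

Lemma proves_ImpI G p q : proves (p :: G) q -> proves G (Imp p q).
Proof.
  intros (L & HL & H). exists L. split; [easy|]. apply ImpI.
  eapply derives_incl; [exact H|]. intros x. simpl. rewrite !in_app_iff. simpl.
  tauto.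
Qed.

Lemma proves_ImpE G p q : proves G (Imp p q) -> proves G p -> proves G q.
Proof.
  intros (L & HL & H) (L' & HL' & H'). exists (L ++ L'). split.
  - intros x. rewrite in_app_iff. intros [|]; auto.
  - apply ImpE with p; eapply derives_incl; eauto;
      intros x; rewrite !in_app_iff; tauto.
Qed.

Lemma proves_Raa G p : proves (Neg p :: G) Bot -> proves G p.
Proof.
  intros (L & HL & H). exists L. split; [easy|]. apply Raa.
  eapply derives_incl; [exact H|]. intros x. simpl. rewrite !in_app_iff. simpl.
  tauto.
Qed.

Lemma consistent_or G p :
  consistent G -> consistent (p :: G) \/ consistent (Neg p :: G).
Proof.
  intros HG. apply NNPP. intros H. apply not_or_and in H as [H1 H2].
  apply NNPP in H1, H2. apply HG. apply proves_ImpE with p.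
  - now apply proves_ImpI.
  - now apply proves_Raa.
Qed.

(** A false universal formula may be given a counterexample: a variable that is
    fresh for the finite list [G]; the axioms, being closed, contain no
    variable. *)
Lemma consistent_witness G p : consistent G -> In (Neg (All p)) G ->
  exists c, consistent (Neg (inst c p) :: G).
Proof.
  intros HG Hin.
  assert (Hc : exists c, forall q, In q (p :: G) -> bounded c q).
  { clear. induction (p :: G) as [|q L [c Hc]].
    - now exists 0.
    - destruct (bounded_exists q) as [n Hn]. exists (n + c).
      intros q' [<-|Hq].
      + apply bounded_mono with n; [lia|easy].
      + apply bounded_mono with c; [lia|auto]. }
  destruct Hc as [c Hc]. exists c. intros H. apply proves_Raa in H.
  apply HG. apply proves_ImpE with (All p).
  - apply proves_derives. now apply Hyp.
  - destruct H as (L & HL & H). exists L. split; [easy|].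
    apply AllI_fresh with c; [| |exact H].
    + intros q. rewrite in_app_iff. intros [Hq|Hq].
      * eapply bounded_mono; [|apply T_closed; auto]. lia.
      * apply Hc. now right.
    + eapply bounded_mono; [|apply Hc; now left]. lia.
Qed.

(** One stage of the Henkin construction: [q] is decided, and if a negated
    universal formula is accepted, a counterexample is provided. *)
Lemma consistent_step G q : consistent G -> exists G', consistent G' /\
  incl G G' /\ (In q G' \/ In (Neg q) G') /\
  (forall p, q = Neg (All p) -> In q G' -> exists c, In (Neg (inst c p)) G').
Proof.
  intros HG. destruct (classic (consistent (q :: G))) as [Hq|Hq].
  - destruct (classic (exists p, q = Neg (All p))) as [[p ->]|Hn].
    + destruct (consistent_witness _ p Hq) as [c Hc]; [now left|].
      exists (Neg (inst c p) :: Neg (All p) :: G). repeat split; auto.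
      * intros x Hx. now do 2 right.
      * left. right. now left.
      * intros p' Hp _. injection Hp as <-. exists c. now left.
    + exists (q :: G). repeat split; auto.
      * intros x Hx. now right.
      * left. now left.
      * intros p Hp. exfalso. eauto.
  - destruct (consistent_or G q HG) as [|Hq']; [easy|].
    exists (Neg q :: G). repeat split; auto.
    + intros x Hx. now right.
    + right. now left.
    + intros p _ Hin. exfalso. apply Hq'. apply proves_ImpE with q.
      * apply proves_derives. apply Hyp. now left.
      * apply proves_derives. now apply Hyp.
Qed.

Variable start : list form.
Hypothesis start_consistent : consistent start.

Definition enum (n : nat) : form := epsilon (inhabits Bot) (fun p => code p = n).

Lemma enum_code p : enum (code p) = p.
Proof.
  apply code_inj. unfold enum.
  apply (epsilon_spec (inhabits Bot) (fun q => code q = code p)). now exists p.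
Qed.

Definition step (q : form) (G : {G | consistent G}) : {G | consistent G} :=
  let (G', H) := constructive_indefinite_description _
    (consistent_step (proj1_sig G) q (proj2_sig G)) in
  exist _ G' (proj1 H).

Fixpoint stage (n : nat) : {G | consistent G} :=
  match n with
  | 0 => exist _ start start_consistent
  | S n => step (enum n) (stage n)
  end.

Definition limit (p : form) : Prop := exists n, In p (proj1_sig (stage n)).

Lemma stage_step n :
  let G := proj1_sig (stage n) in let G' := proj1_sig (stage (S n)) in
  let q := enum n in
  incl G G' /\ (In q G' \/ In (Neg q) G') /\
  (forall p, q = Neg (All p) -> In q G' -> exists c, In (Neg (inst c p)) G').
Proof.
  simpl. unfold step.
  destruct constructive_indefinite_description as [G' (H & H')]. exact H'.
Qed.

Lemma stage_mono n m :
  n <= m -> incl (proj1_sig (stage n)) (proj1_sig (stage m)).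
Proof.
  induction 1; [apply incl_refl|].
  eapply incl_tran; [exact IHle|]. apply stage_step.
Qed.

(** Finitely many members of the limit occur together at some stage, so that
    the limit inherits consistency from the stages. *)
Lemma limit_compact L : (forall q, In q L -> T q \/ limit q) ->
  exists L' n, (forall q, In q L' -> T q) /\
    incl L (L' ++ proj1_sig (stage n)).
Proof.
  induction L as [|q L IH]; intros H.
  - exists [], 0. split; easy.
  - destruct IH as (L' & n & HL & HI); [intros; apply H; now right|].
    destruct (H q (or_introl eq_refl)) as [Hq|[m Hm]].
    + exists (q :: L'), n. split.
      * intros x [<-|Hx]; auto.
      * intros x [<-|Hx]; simpl; auto.
    + exists L', (n + m). split; [easy|].
      assert (H1 := stage_mono n (n + m) ltac:(lia)).
      assert (H2 := stage_mono m (n + m) ltac:(lia)).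
      intros x [<-|Hx]; rewrite in_app_iff; auto.
      apply HI in Hx. rewrite in_app_iff in Hx. destruct Hx; auto.
Qed.

Lemma limit_consistent L :
  (forall q, In q L -> T q \/ limit q) -> ~ derives L Bot.
Proof.
  intros H Hd. destruct (limit_compact L H) as (L' & n & HL & HI).
  apply (proj2_sig (stage n)). exists L'. split; [easy|].
  eapply derives_incl; eauto.
Qed.

Lemma limit_complete p : limit p \/ limit (Neg p).
Proof.
  destruct (stage_step (code p)) as (_ & H & _). rewrite enum_code in H.
  destruct H; [left|right]; eexists; eauto.
Qed.

Lemma limit_closed L p :
  (forall q, In q L -> T q \/ limit q) -> derives L p -> limit p.
Proof.
  intros H Hd. destruct (limit_complete p) as [|Hp]; [easy|].
  exfalso. apply (limit_consistent (Neg p :: L)).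
  - intros q [<-|Hq]; auto.
  - apply ImpE with p; [apply Hyp; now left|].
    eapply derives_incl; [exact Hd|]. intros x Hx. now right.
Qed.

Lemma limit_closed1 q p : limit q -> derives [q] p -> limit p.
Proof. intros Hq. apply limit_closed. intros x [<-|[]]. now right. Qed.

Lemma limit_theory p : T p -> limit p.
Proof.
  intros H. apply (limit_closed [p]); [|apply Hyp; now left].
  intros x [<-|[]]. now left.
Qed.

Lemma limit_Bot : ~ limit Bot.
Proof.
  intros H. apply (limit_consistent [Bot]); [|apply Hyp; now left].
  intros x [<-|[]]. now right.
Qed.

Lemma limit_Imp p q : limit (Imp p q) <-> (limit p -> limit q).
Proof.
  split.
  - intros H Hp. apply (limit_closed [Imp p q; p]).
    + intros x [<-|[<-|[]]]; now right.
    + apply ImpE with p; apply Hyp; simpl; auto.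
  - intros H. destruct (limit_complete p) as [Hp|Hp].
    + apply (limit_closed1 q); [auto|]. apply ImpI, Hyp. simpl; auto.
    + apply (limit_closed1 _ _ Hp). apply ImpI, Raa.
      apply ImpE with p; apply Hyp; simpl; auto.
Qed.

Lemma limit_All p : limit (All p) <-> forall t, limit (inst t p).
Proof.
  split.
  - intros H t. apply (limit_closed1 _ _ H). apply AllE, Hyp. now left.
  - intros H. destruct (limit_complete (All p)) as [|Hn]; [easy|]. exfalso.
    destruct (stage_step (code (Neg (All p)))) as (_ & H1 & H2).
    rewrite enum_code in *.
    destruct H1 as [H1|H1].
    + destruct (H2 p eq_refl H1) as [c Hc]. apply limit_Bot.
      apply (proj1 (limit_Imp (inst c p) Bot)); [|apply H]. eexists; eauto.
    + apply limit_Bot. apply (proj1 (limit_Imp (Neg (All p)) Bot)); [|easy].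
      eexists; eauto.
Qed.

Lemma limit_Eqn_subst p x y :
  limit (Eqn x y) -> limit (inst x p) -> limit (inst y p).
Proof.
  intros H H'. apply (limit_closed [Eqn x y; inst x p]).
  - intros q [<-|[<-|[]]]; now right.
  - apply EqE with x; apply Hyp; simpl; auto.
Qed.

Lemma limit_Eqn_refl x : limit (Eqn x x).
Proof. apply (limit_closed []); [easy|]. apply EqI. Qed.

Lemma limit_Eqn_sym x y : limit (Eqn x y) -> limit (Eqn y x).
Proof.
  intros H. apply (limit_Eqn_subst (Eqn 0 (S x)) x y H). apply limit_Eqn_refl.
Qed.

Lemma limit_Eqn_trans x y z :
  limit (Eqn x y) -> limit (Eqn y z) -> limit (Eqn x z).
Proof. intros H H'. now apply (limit_Eqn_subst (Eqn (S x) 0) y z H'). Qed.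

(** The variables, taken up to provable equality in the limit theory, are the
    elements of the term model; one variable is selected in each class. *)
Definition rep (x : nat) : nat := epsilon (inhabits 0) (fun y => limit (Eqn x y)).

Lemma rep_Eqn x : limit (Eqn x (rep x)).
Proof.
  apply (epsilon_spec (inhabits 0) (fun y => limit (Eqn x y))).
  exists x. apply limit_Eqn_refl.
Qed.

Lemma rep_eq x y : limit (Eqn x y) -> rep x = rep y.
Proof.
  intros H. unfold rep. f_equal. extensionality z.
  apply propositional_extensionality.
  split; intros H'; eauto using limit_Eqn_sym, limit_Eqn_trans.
Qed.

Definition term_model : Type := {x : nat | rep x = x}.

Definition term_model_point : term_model :=
  exist _ (rep 0) (eq_sym (rep_eq 0 (rep 0) (rep_Eqn 0))).

Definition term_mem (d d' : term_model) : Prop :=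
  limit (Mem (proj1_sig d) (proj1_sig d')).

(** Truth in the term model is membership in the limit: the limit decides every
    formula, and its counterexamples account for the quantifier. *)
Lemma term_model_sat p : forall e : nat -> term_model,
  sat term_mem e p <-> limit (rename (fun k => proj1_sig (e k)) p).
Proof.
  induction p; intros e.
  - reflexivity.
  - simpl. split.
    + intros ->. apply limit_Eqn_refl.
    + intros H. apply rep_eq in H. destruct (e n) as [x Hx], (e n0) as [y Hy].
      simpl in H. assert (x = y) as -> by congruence. f_equal.
      apply proof_irrelevance.
  - simpl. split; [easy|]. apply limit_Bot.
  - cbn [sat rename]. now rewrite limit_Imp, IHp1, IHp2.
  - cbn [sat rename]. rewrite limit_All.
    assert (Hinst : forall d, inst (proj1_sig d)
        (rename (up (fun k => proj1_sig (e k))) p) =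
        rename (fun k => proj1_sig (scons d e k)) p).
    { intros d. unfold inst. rewrite rename_comp. apply rename_ext.
      now intros [|k]. }
    split.
    + intros H t.
      assert (Ht : rep (rep t) = rep t).
      { symmetry. apply rep_eq, rep_Eqn. }
      apply limit_Eqn_subst with (rep t); [apply limit_Eqn_sym, rep_Eqn|].
      specialize (H (exist _ (rep t) Ht)). apply IHp in H.
      now rewrite <- Hinst in H.
    + intros H d. apply IHp. rewrite <- Hinst. apply H.
Qed.

End Henkin.

(** Otherwise the negation of [p] is consistent with [T], and the term model of
    its Henkin completion satisfies [T] but not [p]. Closed axioms leave all
    variables free to serve as fresh witnesses. *)
Theorem completeness (T : theory) (p : form) :
  (forall q, T q -> bounded 0 q) -> bounded 0 p ->
  (forall (D : Type) (E : D -> D -> Prop),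
     (forall q, T q -> forall e, sat E e q) -> forall e, sat E e p) ->
  provable T p.
Proof.
  intros HT Hp H. apply NNPP. intros Hn.
  assert (Hc : consistent T [Neg p]).
  { intros H'. apply proves_Raa in H' as (L & HL & Hd). apply Hn.
    exists L. split; [easy|]. now rewrite app_nil_r in Hd. }
  set (lim := limit T HT [Neg p] Hc).
  assert (Hlim : forall e q, bounded 0 q ->
    (sat (term_mem T HT [Neg p] Hc) e q <-> lim q)).
  { intros e q Hq. rewrite term_model_sat. now rewrite rename_closed. }
  set (e := fun _ : nat => term_model_point T HT [Neg p] Hc).
  apply (limit_Bot T HT [Neg p] Hc).
  apply (proj1 (limit_Imp T HT [Neg p] Hc p Bot)).
  - exists 0. now left.
  - apply (Hlim e p Hp). apply H. intros q Hq e'. apply Hlim; [auto|].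
    now apply limit_theory.
Qed.

(** * Set-theoretic notions in a structure *)

Section Structure.

Context {D : Type} (E : D -> D -> Prop).

Definition Empty (x : D) : Prop := forall y, ~ E y x.

Definition Sub (x y : D) : Prop := forall z, E z x -> E z y.

Definition Pair (z x y : D) : Prop := forall w, E w z <-> (w = x \/ w = y).

Definition Union (z x : D) : Prop := forall w, E w z <-> exists v, E v x /\ E w v.

Definition Power (z x : D) : Prop := forall w, E w z <-> Sub w x.

Definition Succ (y x : D) : Prop := forall z, E z y <-> (E z x \/ z = x).

Definition InductiveSet (x : D) : Prop :=
  (exists y, Empty y /\ E y x) /\
  (forall y, E y x -> exists z, Succ z y /\ E z x).

Definition Omega (x : D) : Prop :=
  InductiveSet x /\ (forall y, InductiveSet y -> Sub x y).

Definition OPair (z x y : D) : Prop :=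
  forall w, E w z <-> (Pair w x x \/ Pair w x y).

Definition Maps (f x y : D) : Prop := exists z, OPair z x y /\ E z f.

Definition FunctionOn (f a : D) : Prop :=
  (forall p, E p f -> exists x y, E x a /\ OPair p x y) /\
  (forall x, E x a -> exists y, Maps f x y) /\
  (forall x y z, Maps f x y -> Maps f x z -> y = z).

Definition FunctionTo (f a b : D) : Prop :=
  FunctionOn f a /\ (forall x y, Maps f x y -> E y b).

Definition Bijection (f a b : D) : Prop :=
  FunctionTo f a b /\
  (forall x y z, Maps f x z -> Maps f y z -> x = y) /\
  (forall y, E y b -> exists x, Maps f x y).

Definition Equipotent (a b : D) : Prop := exists f, Bijection f a b.

Definition Natural (n : D) : Prop := exists w, Omega w /\ E n w.

Definition Finite (a : D) : Prop := exists n, Natural n /\ Equipotent a n.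

Definition DedekindInfinite (a : D) : Prop :=
  exists b, (Sub b a /\ ~ b = a) /\ Equipotent b a.

Definition FiniteFamily (F w : D) : Prop :=
  FunctionOn F w /\ (forall n X, Maps F n X -> ~ Empty X /\ Finite X).

Definition FamilyUnion (u F : D) : Prop :=
  forall x, E x u <-> exists n X, Maps F n X /\ E x X.

Definition Choice (f F w : D) : Prop :=
  (exists u, FamilyUnion u F /\ FunctionTo f w u) /\
  (forall n, E n w -> exists X x, Maps F n X /\ Maps f n x /\ E x X).

Lemma sat_Imp e p q P Q : (sat E e p <-> P) -> (sat E e q <-> Q) ->
  (sat E e (Imp p q) <-> (P -> Q)).
Proof. simpl. tauto. Qed.

Lemma sat_Neg e p P : (sat E e p <-> P) -> (sat E e (Neg p) <-> ~ P).
Proof. simpl. tauto. Qed.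

Lemma sat_And e p q P Q : (sat E e p <-> P) -> (sat E e q <-> Q) ->
  (sat E e (And p q) <-> P /\ Q).
Proof.
  simpl. intros <- <-. destruct (classic (sat E e p)), (classic (sat E e q)); tauto.
Qed.

Lemma sat_Or e p q P Q : (sat E e p <-> P) -> (sat E e q <-> Q) ->
  (sat E e (Or p q) <-> P \/ Q).
Proof.
  simpl. intros <- <-. destruct (classic (sat E e p)); tauto.
Qed.

Lemma sat_Iff e p q P Q : (sat E e p <-> P) -> (sat E e q <-> Q) ->
  (sat E e (Iff p q) <-> (P <-> Q)).
Proof. intros. unfold Iff. apply sat_And; now apply sat_Imp. Qed.

Lemma sat_All e p P : (forall d, sat E (scons d e) p <-> P d) ->
  (sat E e (All p) <-> forall d, P d).
Proof. intros H. simpl. split; intros H' d; now apply H. Qed.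

Lemma sat_Ex e p P : (forall d, sat E (scons d e) p <-> P d) ->
  (sat E e (Ex p) <-> exists d, P d).
Proof.
  intros H. simpl. split.
  - intros H'. apply NNPP. intros Hn. apply H'. intros d Hd. apply Hn. exists d.
    now apply H.
  - intros [d Hd] H'. apply (H' d). now apply H.
Qed.

Ltac sat_solve :=
  match goal with
  | |- sat _ _ (Ex _) <-> _ => apply sat_Ex; intros ?; sat_solve
  | |- sat _ _ (All _) <-> _ => apply sat_All; intros ?; sat_solve
  | |- sat _ _ (Iff _ _) <-> _ => apply sat_Iff; sat_solve
  | |- sat _ _ (And _ _) <-> _ => apply sat_And; sat_solve
  | |- sat _ _ (Or _ _) <-> _ => apply sat_Or; sat_solve
  | |- sat _ _ (Neg _) <-> _ => apply sat_Neg; sat_solve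
  | |- sat _ _ (Imp _ _) <-> _ => apply sat_Imp; sat_solve
  | |- sat _ _ (Mem _ _) <-> _ => reflexivity
  | |- sat _ _ (Eqn _ _) <-> _ => reflexivity
  | |- _ => autorewrite with sat; try reflexivity
  end.

Lemma sat_is_empty e x : sat E e (is_empty x) <-> Empty (e x).
Proof. unfold is_empty, Empty. sat_solve. Qed.
Hint Rewrite sat_is_empty : sat.

Lemma sat_subset e x y : sat E e (subset x y) <-> Sub (e x) (e y).
Proof. unfold subset, Sub. sat_solve. Qed.
Hint Rewrite sat_subset : sat.

Lemma sat_is_pair e z x y : sat E e (is_pair z x y) <-> Pair (e z) (e x) (e y).
Proof. unfold is_pair, Pair. sat_solve. Qed.
Hint Rewrite sat_is_pair : sat.

Lemma sat_is_union e z x : sat E e (is_union z x) <-> Union (e z) (e x).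
Proof. unfold is_union, Union. sat_solve. Qed.
Hint Rewrite sat_is_union : sat.

Lemma sat_is_power e z x : sat E e (is_power z x) <-> Power (e z) (e x).
Proof. unfold is_power, Power. sat_solve. Qed.
Hint Rewrite sat_is_power : sat.

Lemma sat_is_succ e y x : sat E e (is_succ y x) <-> Succ (e y) (e x).
Proof. unfold is_succ, Succ. sat_solve. Qed.
Hint Rewrite sat_is_succ : sat.

Lemma sat_inductive_set e x :
  sat E e (inductive_set x) <-> InductiveSet (e x).
Proof. unfold inductive_set, InductiveSet. sat_solve. Qed.
Hint Rewrite sat_inductive_set : sat.

Lemma sat_is_omega e x : sat E e (is_omega x) <-> Omega (e x).
Proof. unfold is_omega, Omega. sat_solve. Qed.
Hint Rewrite sat_is_omega : sat.

Lemma sat_is_opair e z x y :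
  sat E e (is_opair z x y) <-> OPair (e z) (e x) (e y).
Proof. unfold is_opair, OPair. sat_solve. Qed.
Hint Rewrite sat_is_opair : sat.

Lemma sat_maps e f x y : sat E e (maps f x y) <-> Maps (e f) (e x) (e y).
Proof. unfold maps, Maps. sat_solve. Qed.
Hint Rewrite sat_maps : sat.

Lemma sat_function_on e f a :
  sat E e (function_on f a) <-> FunctionOn (e f) (e a).
Proof. unfold function_on, FunctionOn. sat_solve. Qed.
Hint Rewrite sat_function_on : sat.

Lemma sat_function e f a b :
  sat E e (function f a b) <-> FunctionTo (e f) (e a) (e b).
Proof. unfold function, FunctionTo. sat_solve. Qed.
Hint Rewrite sat_function : sat.

Lemma sat_bijection e f a b :
  sat E e (bijection f a b) <-> Bijection (e f) (e a) (e b).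
Proof. unfold bijection, Bijection. sat_solve. Qed.
Hint Rewrite sat_bijection : sat.

Lemma sat_equipotent e a b :
  sat E e (equipotent a b) <-> Equipotent (e a) (e b).
Proof. unfold equipotent, Equipotent. sat_solve. Qed.
Hint Rewrite sat_equipotent : sat.

Lemma sat_is_natural e n : sat E e (is_natural n) <-> Natural (e n).
Proof. unfold is_natural, Natural. sat_solve. Qed.
Hint Rewrite sat_is_natural : sat.

Lemma sat_finite e a : sat E e (finite a) <-> Finite (e a).
Proof. unfold finite, Finite. sat_solve. Qed.
Hint Rewrite sat_finite : sat.

Lemma sat_dedekind_infinite e a :
  sat E e (dedekind_infinite a) <-> DedekindInfinite (e a).
Proof. unfold dedekind_infinite, DedekindInfinite. sat_solve. Qed.
Hint Rewrite sat_dedekind_infinite : sat.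

Lemma sat_family e F w :
  sat E e (family_of_nonempty_finite F w) <-> FiniteFamily (e F) (e w).
Proof. unfold family_of_nonempty_finite, FiniteFamily. sat_solve. Qed.
Hint Rewrite sat_family : sat.

Lemma sat_is_family_union e u F :
  sat E e (is_family_union u F) <-> FamilyUnion (e u) (e F).
Proof. unfold is_family_union, FamilyUnion. sat_solve. Qed.
Hint Rewrite sat_is_family_union : sat.

Lemma sat_choice_function e f F w :
  sat E e (choice_function f F w) <-> Choice (e f) (e F) (e w).
Proof. unfold choice_function, Choice. sat_solve. Qed.
Hint Rewrite sat_choice_function : sat.

Lemma sat_extensionality e : sat E e extensionality <->
  forall x y, (forall z, E z x <-> E z y) -> x = y.
Proof. unfold extensionality. sat_solve. Qed.

Lemma sat_null_set e : sat E e null_set <-> exists x, Empty x.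
Proof. unfold null_set. sat_solve. Qed.

Lemma sat_pair_set e : sat E e pair_set <-> forall x y, exists z, Pair z x y.
Proof. unfold pair_set. sat_solve. Qed.

Lemma sat_union_set e : sat E e union_set <-> forall x, exists z, Union z x.
Proof. unfold union_set. sat_solve. Qed.

Lemma sat_power_set e : sat E e power_set <-> forall x, exists z, Power z x.
Proof. unfold power_set. sat_solve. Qed.

Lemma sat_SD e : sat E e SD <-> forall a, ~ Finite a -> DedekindInfinite a.
Proof. unfold SD, standard_infinite. sat_solve. Qed.

Lemma sat_AC_countable_fin e : sat E e AC_countable_fin <->
  forall w, Omega w -> forall F, FiniteFamily F w -> exists f, Choice f F w.
Proof. unfold AC_countable_fin. sat_solve. Qed.

(** * Definable properties *)

Hypothesis null_set_axiom : exists x, Empty x.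

(** The even positions hold the arguments of a property, the odd positions its
    parameters, so that two definable properties can always be combined. *)
Definition join (e c : nat -> D) (k : nat) : D :=
  if Nat.even k then e (Nat.div2 k) else c (Nat.div2 k).

Lemma join_even e c k : join e c (2 * k) = e k.
Proof. unfold join. now rewrite Nat.even_even, Nat.div2_even. Qed.

Lemma join_odd e c k : join e c (2 * k + 1) = c k.
Proof. unfold join. now rewrite Nat.even_odd, Nat.div2_odd'. Qed.

(** [r] acts on the arguments and [s] on the parameters. *)
Definition split_index (r s : nat -> nat) (k : nat) : nat :=
  if Nat.even k then r (Nat.div2 k) else s (Nat.div2 k).

Lemma split_index_join r s (e e' c : nat -> D) :
  (forall k, e (r k) = e' k) -> (forall k, e (s k) = c k) ->
  forall k, e (split_index r s k) = join e' c k.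
Proof. intros H H' k. unfold split_index, join. now destruct (Nat.even k). Qed.

(** First-order definability with parameters. Comprehension applies to exactly
    the properties of this kind, and the closure lemmas below establish
    definability from the syntactic shape of a property. *)
Definition dfn (P : (nat -> D) -> Prop) : Prop :=
  exists p c, forall e, P e <-> sat E (join e c) p.

Definition tm (f : (nat -> D) -> D) : Prop :=
  (exists k, forall e, f e = e k) \/ (exists d, forall e, f e = d).

Lemma tm_index f : tm f -> forall j, exists d i,
  forall e c, c j = d -> f e = join e c i.
Proof.
  intros [[k Hk]|[d Hd]] j.
  - destruct null_set_axiom as [d _]. exists d, (2 * k). intros e c _.
    now rewrite join_even.
  - exists d, (2 * j + 1). intros e c Hc. now rewrite join_odd, Hc.
Qed.

Lemma tm_index2 f g : tm f -> tm g -> exists c i j,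
  forall e, f e = join e c i /\ g e = join e c j.
Proof.
  intros Hf Hg. destruct (tm_index f Hf 0) as (d & i & Hi).
  destruct (tm_index g Hg 1) as (d' & j & Hj).
  exists (scons d (fun _ => d')), i, j. intros e. split; auto.
Qed.

Lemma dfn_mem f g : tm f -> tm g -> dfn (fun e => E (f e) (g e)).
Proof.
  intros Hf Hg. destruct (tm_index2 f g Hf Hg) as (c & i & j & H).
  exists (Mem i j), c. intros e. destruct (H e) as [-> ->]. reflexivity.
Qed.

Lemma dfn_eq f g : tm f -> tm g -> dfn (fun e => f e = g e).
Proof.
  intros Hf Hg. destruct (tm_index2 f g Hf Hg) as (c & i & j & H).
  exists (Eqn i j), c. intros e. destruct (H e) as [-> ->]. reflexivity.
Qed.

Lemma dfn_iff P Q : (forall e, P e <-> Q e) -> dfn P -> dfn Q.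
Proof.
  intros H (p & c & Hp). exists p, c. intros e. now rewrite <- H, Hp.
Qed.

Lemma dfn_imp P Q : dfn P -> dfn Q -> dfn (fun e => P e -> Q e).
Proof.
  intros (p & c & Hp) (q & c' & Hq).
  exists (Imp (rename (split_index (fun k => 2 * k) (fun k => 2 * (2 * k) + 1)) p)
    (rename (split_index (fun k => 2 * k) (fun k => 2 * (2 * k + 1) + 1)) q)).
  exists (join c c'). intros e. cbn [sat]. rewrite Hp, Hq.
  rewrite (sat_rename _ E p _ (join e c)), (sat_rename _ E q _ (join e c')).
  - reflexivity.
  - apply split_index_join; intros k; now rewrite ?join_odd, ?join_even.
  - apply split_index_join; intros k; now rewrite ?join_odd, ?join_even.
Qed.

Lemma dfn_False : dfn (fun _ => False).
Proof.
  destruct null_set_axiom as [d _]. now exists Bot, (fun _ => d).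
Qed.

Lemma dfn_not P : dfn P -> dfn (fun e => ~ P e).
Proof. intros H. apply dfn_imp; [easy|apply dfn_False]. Qed.

Lemma dfn_and P Q : dfn P -> dfn Q -> dfn (fun e => P e /\ Q e).
Proof.
  intros HP HQ. apply dfn_iff with (fun e => ~ (P e -> ~ Q e)).
  - intros e. tauto.
  - now apply dfn_not, dfn_imp, dfn_not.
Qed.

Lemma dfn_or P Q : dfn P -> dfn Q -> dfn (fun e => P e \/ Q e).
Proof.
  intros HP HQ. apply dfn_iff with (fun e => ~ P e -> Q e).
  - intros e. tauto.
  - now apply dfn_imp; [apply dfn_not|].
Qed.

Lemma dfn_equiv P Q : dfn P -> dfn Q -> dfn (fun e => P e <-> Q e).
Proof. intros HP HQ. now apply dfn_and; apply dfn_imp. Qed.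

Lemma dfn_forall (P : (nat -> D) -> D -> Prop) :
  dfn (fun e => P (fun k => e (S k)) (e 0)) -> dfn (fun e => forall d, P e d).
Proof.
  intros (p & c & H).
  exists (All (rename (split_index
    (fun k => match k with 0 => 0 | S k => S (2 * k) end)
    (fun k => S (2 * k + 1))) p)), c.
  intros e. cbn [sat].
  assert (Hd : forall d, P e d <-> sat E (scons d (join e c)) (rename (split_index
    (fun k => match k with 0 => 0 | S k => S (2 * k) end)
    (fun k => S (2 * k + 1))) p)).
  { intros d. rewrite (H (scons d e)). symmetry. apply sat_rename.
    apply split_index_join.
    - intros [|k]; [easy|]. exact (join_even e c k).
    - intros k. exact (join_odd e c k). }
  split; intros H' d; now apply Hd.
Qed.

Lemma dfn_exists (P : (nat -> D) -> D -> Prop) :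
  dfn (fun e => P (fun k => e (S k)) (e 0)) -> dfn (fun e => exists d, P e d).
Proof.
  intros H. apply dfn_iff with (fun e => ~ forall d, ~ P e d).
  - intros e. split; [|firstorder]. intros H'. apply NNPP. firstorder.
  - apply dfn_not, (dfn_forall (fun e d => ~ P e d)), dfn_not, H.
Qed.

Lemma dfn_rename r P : dfn P -> dfn (fun e => P (fun k => e (r k))).
Proof.
  intros (p & c & Hp).
  exists (rename (split_index (fun k => 2 * r k) (fun k => 2 * k + 1)) p), c.
  intros e. rewrite Hp. symmetry. apply sat_rename.
  apply split_index_join; intros k; [apply join_even|apply join_odd].
Qed.

(** Substitution of terms is reduced to renaming by quantifying over elements
    that equal the terms. *)
Lemma dfn_rel (R : D -> D -> Prop) f g : dfn (fun e => R (e 0) (e 1)) ->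
  tm f -> tm g -> dfn (fun e => R (f e) (g e)).
Proof.
  intros HR Hf Hg.
  assert (Htm : forall h j, tm h -> tm (fun e => h (fun k => e (j + k)))).
  { intros h j [[k Hk]|[d Hd]]; [left; exists (j + k)|right; exists d];
      intros e; auto. }
  apply dfn_iff with (fun e => forall d, d = f e -> forall d', d' = g e -> R d d').
  - intros e. split; [auto|]. now intros H d -> d' ->.
  - apply (dfn_forall (fun e d => d = f e -> forall d', d' = g e -> R d d')).
    apply dfn_imp.
    { apply dfn_eq; [left; now exists 0|]. now apply (Htm f 1). }
    apply (dfn_forall (fun e d' => d' = g (fun k => e (S k)) -> R (e 0) d')).
    apply dfn_imp.
    + apply dfn_eq; [left; now exists 0|]. now apply (Htm g 2).
    + exact (dfn_rename (fun k => match k with 0 => 1 | _ => 0 end) _ HR).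
Qed.

Lemma dfn_pred (P : D -> Prop) f :
  dfn (fun e => P (e 0)) -> tm f -> dfn (fun e => P (f e)).
Proof. intros HP Hf. now apply (dfn_rel (fun x _ => P x) f f). Qed.

Ltac term := solve [right; eexists; intros ?; reflexivity
                   |left; eexists; intros ?; reflexivity].

(** Set-theoretic notions are unfolded down to membership and equality. *)
Ltac definable :=
  cbv beta;
  lazymatch goal with
  | |- dfn (fun e => @?A e /\ @?B e) => apply (dfn_and A B); definable
  | |- dfn (fun e => @?A e \/ @?B e) => apply (dfn_or A B); definable
  | |- dfn (fun e => @?A e <-> @?B e) => apply (dfn_equiv A B); definable
  | |- dfn (fun e => ~ @?A e) => apply (dfn_not A); definable
  | |- dfn (fun e => exists x, @?A e x) => apply (dfn_exists A); definable
  | |- dfn (fun e => E (@?f e) (@?g e)) => apply (dfn_mem f g); term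
  | |- dfn (fun e => @?f e = @?g e) => apply (dfn_eq f g); term
  | H : dfn (fun e => ?P (e 0)) |- dfn (fun e => ?P (@?f e)) =>
      apply (dfn_pred P f H); term
  | H : dfn (fun e => ?R (e 0) (e 1)) |- dfn (fun e => ?R (@?f e) (@?g e)) =>
      apply (dfn_rel R f g H); term
  | |- dfn (fun e => @?A e -> @?B e) => apply (dfn_imp A B); definable
  | |- dfn (fun e => forall x : D, @?A e x) => apply (dfn_forall A); definable
  | |- _ => progress autounfold with notions; definable
  end.

Hint Unfold Empty Sub Pair Union Power Succ OPair Maps : notions.

Definition comprehension_axiom : Prop :=
  forall n p, bounded (S n) p -> forall e, sat E e (comprehension n p).

Lemma sat_alls n p : (forall e, sat E e (alls n p)) -> forall e, sat E e p.
Proof.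
  induction n as [|n IH]; simpl; [easy|]. intros H. apply IH. intros e.
  rewrite sat_ext; [exact (H (fun k => e (S k)) (e 0))|]. now intros [|k].
Qed.

Hypothesis comprehension_holds : comprehension_axiom.

(** The parameters of a definable property are the universally quantified ones
    of a comprehension instance, and all its argument positions are identified
    with index 0. *)
Lemma separation (P : D -> Prop) : dfn (fun e => P (e 0)) ->
  forall a, exists b, forall x, E x b <-> E x a /\ P x.
Proof.
  intros (p & c & Hp) a.
  destruct (bounded_exists p) as [n Hn].
  set (q := rename (split_index (fun _ => 0) S) p).
  assert (Hq : forall x, sat E (scons x c) q <-> P x).
  { intros x. rewrite (Hp (fun _ => x)). apply sat_rename.
    now apply split_index_join. }
  assert (Hb : bounded (S n) q).
  { apply bounded_rename with n; [exact Hn|]. intros k Hk. unfold split_index.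
    assert (Nat.div2 k <= k) by apply Nat.div2_decr, Nat.le_succ_diag_r.
    destruct (Nat.even k); lia. }
  assert (H := sat_alls _ _ (comprehension_holds n q Hb) c).
  enough (H' : forall a, exists b, forall x, E x b <-> E x a /\ P x) by apply H'.
  revert H. match goal with |- ?A -> ?B => enough (A <-> B) by tauto end.
  sat_solve. rewrite <- Hq. apply sat_rename. now intros [|k].
Qed.

(** * Elementary set theory *)

Hypothesis extensionality_axiom :
  forall x y, (forall z, E z x <-> E z y) -> x = y.
Hypothesis pair_axiom : forall x y, exists z, Pair z x y.
Hypothesis union_axiom : forall x, exists z, Union z x.
Hypothesis power_axiom : forall x, exists z, Power z x.

Lemma Pair_inj z x y x' y' : Pair z x y -> Pair z x' y' ->
  (x = x' /\ y = y') \/ (x = y' /\ y = x').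
Proof.
  intros H H'.
  assert (Hx : x = x' \/ x = y') by (apply H', H; now left).
  assert (Hy : y = x' \/ y = y') by (apply H', H; now right).
  assert (Hx' : x' = x \/ x' = y) by (apply H, H'; now left).
  assert (Hy' : y' = x \/ y' = y) by (apply H, H'; now right).
  intuition congruence.
Qed.

Lemma OPair_exists x y : exists z, OPair z x y.
Proof.
  destruct (pair_axiom x x) as [s Hs], (pair_axiom x y) as [p Hp].
  destruct (pair_axiom s p) as [z Hz]. exists z. intros w. rewrite (Hz w).
  split; (intros [H|H]; [left|right]).
  - now subst.
  - now subst.
  - apply extensionality_axiom. intros v. now rewrite (H v), (Hs v).
  - apply extensionality_axiom. intros v. now rewrite (H v), (Hp v).
Qed.

Lemma OPair_ext z z' x y : OPair z x y -> OPair z' x y -> z = z'.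
Proof.
  intros H H'. apply extensionality_axiom. intros w. now rewrite (H w), (H' w).
Qed.

Lemma OPair_inj z x y x' y' :
  OPair z x y -> OPair z x' y' -> x = x' /\ y = y'.
Proof.
  intros H H'.
  assert (x = x') as <-.
  { destruct (pair_axiom x x) as [s Hs].
    assert (Hin : E s z) by (apply H; now left).
    apply H' in Hin as [Hin|Hin]; apply (Pair_inj _ _ _ _ _ Hs) in Hin;
      intuition congruence. }
  split; [easy|].
  destruct (pair_axiom x y) as [p Hp], (pair_axiom x y') as [p' Hp'].
  assert (Hin : E p z) by (apply H; now right).
  assert (Hin' : E p' z) by (apply H'; now right).
  apply H' in Hin. apply H in Hin'.
  destruct Hin as [Hin|Hin]; apply (Pair_inj _ _ _ _ _ Hp) in Hin;
    destruct Hin' as [Hin'|Hin']; apply (Pair_inj _ _ _ _ _ Hp') in Hin';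
    intuition congruence.
Qed.

Lemma Maps_mem f x y z : OPair z x y -> (Maps f x y <-> E z f).
Proof.
  intros Hz. split.
  - intros (z' & Hz' & H). now rewrite (OPair_ext _ _ _ _ Hz Hz').
  - intros H. now exists z.
Qed.

Lemma binary_union a b : exists c, forall x, E x c <-> E x a \/ E x b.
Proof.
  destruct (pair_axiom a b) as [p Hp], (union_axiom p) as [c Hc]. exists c.
  intros x. rewrite (Hc x). split.
  - intros (v & Hv & Hx). apply Hp in Hv as [->| ->]; auto.
  - intros [Hx|Hx]; [exists a|exists b]; rewrite (Hp _); auto.
Qed.

Lemma product_bound a b :
  exists c, forall x y z, E x a -> E y b -> OPair z x y -> E z c.
Proof.
  destruct (binary_union a b) as [u Hu].
  destruct (power_axiom u) as [p Hp], (power_axiom p) as [c Hc]. exists c.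
  intros x y z Hx Hy Hz. apply Hc. intros w Hw. apply Hp. intros v Hv.
  apply Hu. apply Hz in Hw as [Hw|Hw]; apply Hw in Hv as [->| ->]; auto.
Qed.

(** A definable relation between two sets is a set, because all the pairs that
    it can contain lie in the double power set of the union. *)
Lemma relation_exists (R : D -> D -> Prop) :
  dfn (fun e => R (e 0) (e 1)) -> forall a b, exists r,
  (forall p, E p r -> exists x y, E x a /\ OPair p x y) /\
  (forall x y, Maps r x y <-> E x a /\ E y b /\ R x y).
Proof.
  intros HR a b. destruct (product_bound a b) as [c Hc].
  destruct (separation (fun p => exists x y, OPair p x y /\ E x a /\ E y b /\ R x y))
    with (a := c) as [r Hr]; [definable|].
  exists r. split.
  - intros p Hp. apply Hr in Hp as (_ & x & y & Hp). exists x, y. tauto.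
  - intros x y. split.
    + intros (p & Hp & Hpr). apply Hr in Hpr as (_ & x' & y' & Hp' & H).
      destruct (OPair_inj _ _ _ _ _ Hp Hp') as [-> ->]. easy.
    + intros (Hx & Hy & H). destruct (OPair_exists x y) as [p Hp].
      exists p. split; [easy|]. apply Hr. split; eauto 8.
Qed.

(** * Natural numbers *)

Lemma Succ_ext s s' n : Succ s n -> Succ s' n -> s = s'.
Proof.
  intros H H'. apply extensionality_axiom. intros w. now rewrite (H w), (H' w).
Qed.

Section Naturals.

Context (w : D) (w_omega : Omega w).

Lemma omega_zero z : Empty z -> E z w.
Proof.
  intros Hz. destruct w_omega as [[(z' & Hz' & Hw) _] _].
  replace z with z'; [easy|]. apply extensionality_axiom. firstorder.
Qed.

Lemma succ_exists n : E n w -> exists s, Succ s n /\ E s w.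
Proof. apply w_omega. Qed.

Lemma omega_ind (P : D -> Prop) : dfn (fun e => P (e 0)) ->
  (forall z, Empty z -> P z) ->
  (forall n s, E n w -> P n -> Succ s n -> P s) ->
  forall n, E n w -> P n.
Proof.
  intros HP H0 HS n Hn. destruct (separation P HP w) as [b Hb].
  apply (Hb n). revert n Hn. apply w_omega. split.
  - destruct null_set_axiom as [z Hz]. exists z. split; [easy|].
    apply Hb. auto using omega_zero.
  - intros n Hn. apply Hb in Hn as [Hn HPn].
    destruct (succ_exists n Hn) as (s & Hs & Hw).
    exists s. split; [easy|]. apply Hb. eauto.
Qed.

Lemma omega_trans n : E n w -> forall m k, E m n -> E k m -> E k n.
Proof.
  revert n. apply (omega_ind (fun n => forall m k, E m n -> E k m -> E k n)).
  - definable.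
  - intros z Hz m k Hm. now destruct (Hz m).
  - intros n s _ IH Hs m k Hm Hk. apply Hs. left.
    apply Hs in Hm as [Hm| ->]; eauto.
Qed.

Lemma omega_elem n : E n w -> forall m, E m n -> E m w.
Proof.
  revert n. apply (omega_ind (fun n => forall m, E m n -> E m w)).
  - definable.
  - intros z Hz m Hm. now destruct (Hz m).
  - intros n s Hn IH Hs m Hm. apply Hs in Hm as [Hm| ->]; auto.
Qed.

Lemma omega_irrefl n : E n w -> ~ E n n.
Proof.
  revert n. apply (omega_ind (fun n => ~ E n n)).
  - definable.
  - intros z Hz. apply Hz.
  - intros n s Hn IH Hs Hss. apply IH.
    assert (Hns : E n s) by (apply Hs; now right).
    apply Hs in Hss as [Hss| ->]; [|easy]. now apply omega_trans with s.
Qed.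

(** Domains of partial choices are compared by inclusion, which this turns into
    membership. *)
Lemma omega_sub_cases m :
  E m w -> forall i, E i w -> Sub i m -> i = m \/ E i m.
Proof.
  revert m.
  apply (omega_ind (fun m => forall i, E i w -> Sub i m -> i = m \/ E i m)).
  - definable.
  - intros z Hz i _ Hi. left. apply extensionality_axiom. firstorder.
  - intros m s Hm IH Hs i Hi Hsub. destruct (classic (E m i)) as [Hmi|Hmi].
    + left. apply extensionality_axiom. intros k. split; [apply Hsub|].
      intros Hk. apply Hs in Hk as [Hk| ->]; [|easy].
      now apply omega_trans with m.
    + right. apply Hs. destruct (IH i Hi) as [->|Hin]; auto.
      intros k Hk. assert (Hks := Hsub k Hk).
      apply Hs in Hks as [Hks| ->]; easy.
Qed.

Lemma omega_linear i j : E i w -> E j w -> Sub i j \/ Sub j i.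
Proof.
  intros Hi. revert j. apply (omega_ind (fun j => Sub i j \/ Sub j i)).
  - definable.
  - intros z Hz. right. intros k Hk. now destruct (Hz k).
  - intros j s Hj IH Hs. destruct IH as [IH|IH].
    + left. intros k Hk. apply Hs. auto.
    + destruct (omega_sub_cases i Hi j Hj IH) as [->|Hji].
      * left. intros k Hk. apply Hs. auto.
      * right. intros k Hk. apply Hs in Hk as [Hk| ->]; auto.
Qed.

End Naturals.

(** If [R x l] is read as saying that [l] bounds [x], finitely many elements
    have a common bound in a directed class: by induction along the bijection
    with a natural number, two bounds are replaced by one at each step. This
    bounds the lengths in a finite set of partial choices, and it is also the
    pigeonhole principle, with thresholds beyond which a value does not occur
    in the role of the bounds. *)
Lemma finite_bound A (L : D -> Prop) (R : D -> D -> Prop) :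
  dfn (fun e => L (e 0)) -> dfn (fun e => R (e 0) (e 1)) ->
  (exists l, L l) ->
  (forall l l', L l -> L l' ->
     exists l'', L l'' /\ forall x, R x l \/ R x l' -> R x l'') ->
  Finite A -> (forall x, E x A -> exists l, L l /\ R x l) ->
  exists l, L l /\ forall x, E x A -> R x l.
Proof.
  intros HL HR Hne Hdir (n & (w & Hw & Hn) & g & Hg & Hinj & _) HA.
  destruct Hg as [(Hdom & Htot & _) Hran].
  assert (Hk : forall k, E k w ->
    exists l, L l /\ forall x j, E j k -> Maps g x j -> R x l).
  { apply (omega_ind w Hw (fun k =>
      exists l, L l /\ forall x j, E j k -> Maps g x j -> R x l)).
    - definable.
    - intros z Hz. destruct Hne as [l Hl]. exists l. split; [easy|].
      intros x j Hj. now destruct (Hz j).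
    - intros k s _ (l & Hl & IH) Hs.
      destruct (classic (exists x, Maps g x k)) as [[x Hx]|Hnx].
      + assert (HxA : E x A).
        { destruct Hx as (p & Hp & Hpg).
          destruct (Hdom p Hpg) as (x' & y' & HxA & Hp').
          now destruct (OPair_inj _ _ _ _ _ Hp Hp') as [-> _]. }
        destruct (HA x HxA) as (l' & Hl' & Hx').
        destruct (Hdir l l' Hl Hl') as (l'' & Hl'' & H).
        exists l''. split; [easy|]. intros y j Hj Hy. apply H.
        apply Hs in Hj as [Hj| ->]; [left; eauto|right].
        now rewrite (Hinj y x k Hy Hx).
      + exists l. split; [easy|]. intros y j Hj Hy.
        apply Hs in Hj as [Hj| ->]; [eauto|]. exfalso. eauto. }
  destruct (Hk n Hn) as (l & Hl & H). exists l. split; [easy|].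
  intros x Hx. destruct (Htot x Hx) as [j Hj]. eauto.
Qed.

(** * Orbits of an injection that is not surjective *)

(** The consequences of having order type omega that select a choice function.
    Working from them avoids an isomorphism with omega, and so the recursion
    theorem. Unboundedness refers to arbitrary [t], because [t] is compared with
    partial choices that need not lie in [O]. *)
Record OmegaOrder (O : D -> Prop) (R : D -> D -> Prop) : Prop := {
  oo_dfn_class : dfn (fun e => O (e 0));
  oo_dfn : dfn (fun e => R (e 0) (e 1));
  oo_inhabited : exists x, O x;
  oo_upward : forall x y, O x -> R x y -> O y;
  oo_refl : forall x, R x x;
  oo_trans : forall x y z, R x y -> R y z -> R x z;
  oo_antisym : forall x y, O x -> R x y -> R y x -> x = y;
  oo_linear : forall x y, O x -> O y -> R x y \/ R y x;
  oo_least : forall S : D -> Prop, dfn (fun e => S (e 0)) ->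
    forall t, O t -> S t ->
    exists s, O s /\ S s /\ forall t, O t -> S t -> R s t;
  oo_unbounded : forall x t, O x -> exists z, R x z /\ ~ R z t
}.

Section Orbit.

Context (Y y0 : D) (N : D -> D -> Prop).
Hypothesis N_dfn : dfn (fun e => N (e 0) (e 1)).
Hypothesis y0_Y : E y0 Y.
Hypothesis N_total : forall x, E x Y -> exists y, N x y.
Hypothesis N_Y : forall x y, N x y -> E y Y.
Hypothesis N_functional : forall x y z, N x y -> N x z -> y = z.
Hypothesis N_injective : forall x y z, N x z -> N y z -> x = y.
Hypothesis N_y0 : forall x, ~ N x y0.

(** [y] is reached from [x] by iterating [N]; quantifying over the sets closed
    under [N] replaces the numbering of the iterates. *)
Definition le (x y : D) : Prop :=
  forall S, E x S -> (forall u v, E u S -> N u v -> E v S) -> E y S.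

Lemma le_dfn : dfn (fun e => le (e 0) (e 1)).
Proof. unfold le. definable. Qed.

Lemma le_refl x : le x x.
Proof. now intros S. Qed.

Lemma le_next x y z : le x y -> N y z -> le x z.
Proof. intros H HN S Hx HS. eapply HS; [|exact HN]. now apply H. Qed.

Lemma le_trans x y z : le x y -> le y z -> le x z.
Proof. intros H H' S Hx HS. apply H'; [|easy]. now apply H. Qed.

(** Comprehension applies only inside a set, hence the restriction of the
    starting point to [Y]. *)
Lemma le_ind (P : D -> Prop) x : dfn (fun e => P (e 0)) -> E x Y -> P x ->
  (forall u v, le x u -> P u -> N u v -> P v) -> forall y, le x y -> P y.
Proof.
  intros HP Hx Hbase Hstep y Hy. assert (Hle := le_dfn).
  destruct (separation (fun u => P u /\ le x u)) with (a := Y) as [S HS];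
    [definable|].
  apply (HS y). apply Hy.
  - apply HS. auto using le_refl.
  - intros u v Hu HN. apply HS in Hu as (Hu & HPu & Hxu). apply HS.
    repeat split; [now apply N_Y with u|now apply Hstep with u|].
    now apply le_next with u.
Qed.

Lemma le_Y x y : E x Y -> le x y -> E y Y.
Proof. intros Hx H. apply H; eauto. Qed.

Lemma le_first x y : E x Y -> le x y -> x = y \/ exists z, N x z /\ le z y.
Proof.
  intros Hx. assert (Hle := le_dfn).
  revert y. apply (le_ind (fun y => x = y \/ exists z, N x z /\ le z y)).
  - definable.
  - easy.
  - now left.
  - intros u v _ [<-|(z & Hz & Hzu)] HN; right.
    + exists v. auto using le_refl.
    + exists z. eauto using le_next.
Qed.

Lemma le_last x y : E x Y -> le x y -> x = y \/ exists z, le x z /\ N z y.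
Proof.
  intros Hx. assert (Hle := le_dfn).
  revert y. apply (le_ind (fun y => x = y \/ exists z, le x z /\ N z y)).
  - definable.
  - easy.
  - now left.
  - intros u v Hu _ HN. right. now exists u.
Qed.

(** A cycle could be traced back along the injection to [y0], which has no
    predecessor. *)
Lemma le_acyclic x : le y0 x -> forall z, N x z -> ~ le z x.
Proof.
  assert (Hle := le_dfn).
  revert x. apply (le_ind (fun x => forall z, N x z -> ~ le z x)).
  - definable.
  - easy.
  - intros z Hz H.
    destruct (le_last z y0 (N_Y _ _ Hz) H) as [->|(u & _ & Hu)].
    + now apply (N_y0 y0).
    + now apply (N_y0 u).
  - intros u x Hu IH HN z Hz H.
    apply (IH x HN).
    assert (Hxz : le x z) by (apply le_next with x; [apply le_refl|easy]).
    destruct (le_last z x (N_Y _ _ Hz) H) as [->|(u' & Hu' & HN')].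
    + rewrite (N_injective u x x HN Hz). apply le_refl.
    + rewrite (N_injective u u' x HN HN'). now apply le_trans with z.
Qed.

Lemma le_antisym x y : le y0 x -> le x y -> le y x -> x = y.
Proof.
  intros Hx Hxy Hyx.
  destruct (le_first x y (le_Y _ _ y0_Y Hx) Hxy) as [|(z & Hz & Hzy)]; [easy|].
  exfalso. apply (le_acyclic x Hx z Hz). now apply le_trans with y.
Qed.

Lemma le_linear x y : le y0 x -> le y0 y -> le x y \/ le y x.
Proof.
  intros Hx. assert (Hle := le_dfn).
  revert y. apply (le_ind (fun y => le x y \/ le y x)).
  - definable.
  - easy.
  - now right.
  - intros y z Hy [IH|IH] HN.
    + left. now apply le_next with y.
    + destruct (le_first y x (le_Y _ _ y0_Y Hy) IH) as [->|(z' & Hz' & Hzx)].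
      * left. apply le_next with x; [apply le_refl|easy].
      * right. now rewrite (N_functional y z z' HN Hz').
Qed.

(** Without a least element of [S], every member of the orbit would be a lower
    bound of [S], in particular every element of [S]. *)
Lemma le_least (S : D -> Prop) : dfn (fun e => S (e 0)) ->
  forall t, le y0 t -> S t ->
  exists s, le y0 s /\ S s /\ forall t, le y0 t -> S t -> le s t.
Proof.
  intros HS t Ht HSt. assert (Hle := le_dfn). apply NNPP. intros Hn.
  assert (H : forall x, le y0 x -> forall t, le y0 t -> S t -> le x t).
  { apply (le_ind (fun x => forall t, le y0 t -> S t -> le x t)).
    - definable.
    - easy.
    - easy.
    - intros u v Hu IH HN t' Ht' HSt'.
      destruct (le_first u t') as [->|(z & Hz & Hzt)]; auto.
      + now apply le_Y with y0.
      + exfalso. apply Hn. now exists t'.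
      + now rewrite (N_functional u v z HN Hz). }
  apply Hn. exists t. eauto.
Qed.

(** If [x] is below [t], then [t] has a successor in the orbit, which is not
    below [t] because there are no cycles. *)
Lemma le_unbounded x t : le y0 x -> exists z, le x z /\ ~ le z t.
Proof.
  intros Hx. destruct (classic (le x t)) as [Hxt|Hxt].
  - assert (Ht : le y0 t) by now apply le_trans with x.
    destruct (N_total t) as [z Hz]; [now apply le_Y with y0|].
    exists z. split; [now apply le_next with t|]. now apply le_acyclic.
  - exists x. split; [apply le_refl|easy].
Qed.

Lemma orbit_order : OmegaOrder (le y0) le.
Proof.
  assert (Hle := le_dfn). split.
  - definable.
  - exact Hle.
  - exists y0. apply le_refl.
  - apply le_trans.
  - apply le_refl.
  - apply le_trans.
  - apply le_antisym.
  - apply le_linear.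
  - apply le_least.
  - apply le_unbounded.
Qed.

End Orbit.

(** The inverse of a bijection from a proper subset onto [Y] is an injection of
    [Y] into itself that misses some [y0]. *)
Lemma DedekindInfinite_order Y : DedekindInfinite Y ->
  exists O R, OmegaOrder O R /\ forall x, O x -> E x Y.
Proof.
  intros (b & [Hsub Hneq] & h & [[(Hdom & _ & Hfun) Hran] [Hinj Hsur]]).
  assert (Hy0 : exists y0, E y0 Y /\ ~ E y0 b).
  { apply NNPP. intros Hn. apply Hneq, extensionality_axiom. intros z.
    split; [apply Hsub|]. intros Hz. apply NNPP. intros Hzb. apply Hn. eauto. }
  destruct Hy0 as (y0 & Hy0 & Hy0b).
  assert (Hb : forall x y, Maps h x y -> E x b).
  { intros x y (p & Hp & Hph). destruct (Hdom p Hph) as (x' & y' & Hx & Hp').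
    now destruct (OPair_inj _ _ _ _ _ Hp Hp') as [-> _]. }
  set (N := fun x y => Maps h y x).
  exists (le N y0), (le N). split.
  - apply (orbit_order Y); unfold N; eauto.
    definable.
  - intros x Hx. apply (le_Y Y N) with y0; unfold N; eauto.
Qed.

(** * The choice function *)

Section CountableChoice.

Hypothesis SD_holds : forall a, ~ Finite a -> DedekindInfinite a.

Context (w F : D) (w_omega : Omega w) (F_family : FiniteFamily F w).

Definition Value (n x : D) : Prop := exists X, Maps F n X /\ E x X.

(** The domain is an initial segment of omega, so that a proper extension of
    [s] is always defined at [m]. *)
Definition PartialChoice (s m : D) : Prop :=
  (forall p, E p s -> exists n x, E n m /\ Value n x /\ OPair p n x) /\
  (forall n, E n m -> exists x, Maps s n x) /\
  (forall n x y, Maps s n x -> Maps s n y -> x = y).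

Hint Unfold Value PartialChoice : notions.

Lemma Value_exists n : E n w -> exists x, Value n x.
Proof.
  intros Hn. destruct F_family as [(_ & Htot & _) H].
  destruct (Htot n Hn) as [X HX]. destruct (H n X HX) as [Hne _].
  apply NNPP. intros Hx. apply Hne. intros x HxX. apply Hx. now exists x, X.
Qed.

(** The pairs in [F] are Kuratowski pairs, so the elements of the values lie
    three unions below [F]. *)
Lemma family_union_exists : exists u, FamilyUnion u F.
Proof.
  destruct (union_axiom F) as [u1 H1], (union_axiom u1) as [u2 H2],
    (union_axiom u2) as [u3 H3].
  destruct (separation (fun x => exists n, Value n x)) with (a := u3) as [u Hu];
    [definable|].
  exists u. intros x. rewrite (Hu x). split.
  - intros (_ & n & X & H). now exists n, X.
  - intros (n & X & HX & Hx). split; [|now exists n, X].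
    destruct HX as (p & Hp & HpF). destruct (pair_axiom n X) as [q Hq].
    apply H3. exists X. split; [|easy].
    apply H2. exists q. split; [|apply Hq; now right].
    apply H1. exists p. split; [easy|]. apply Hp. now right.
Qed.

Lemma PartialChoice_Maps s m n x :
  PartialChoice s m -> Maps s n x -> E n m /\ Value n x.
Proof.
  intros (H & _) (p & Hp & Hps). destruct (H p Hps) as (n' & x' & Hn & Hx & Hp').
  destruct (OPair_inj _ _ _ _ _ Hp Hp') as [-> ->]. easy.
Qed.

Lemma PartialChoice_empty z : Empty z -> PartialChoice z z.
Proof.
  intros Hz. split; [|split].
  - intros p Hp. now destruct (Hz p).
  - intros n Hn. now destruct (Hz n).
  - intros n x y (p & _ & Hp). now destruct (Hz p).
Qed.

Lemma PartialChoice_extend t i s x : E i w -> PartialChoice t i -> Succ s i ->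
  Value i x -> exists t', PartialChoice t' s /\ Sub t t' /\
    forall p, E p t' -> E p t \/ OPair p i x.
Proof.
  intros Hi Ht Hs Hx. destruct (OPair_exists i x) as [q Hq].
  destruct (pair_axiom q q) as [q1 Hq1], (binary_union t q1) as [t' Ht'].
  assert (Hmaps : forall n y, Maps t' n y <-> Maps t n y \/ (n = i /\ y = x)).
  { intros n y. split.
    - intros (p & Hp & Hpt). apply Ht' in Hpt as [Hpt|Hpt].
      + left. now exists p.
      + right. assert (p = q) as -> by (apply Hq1 in Hpt; tauto).
        exact (OPair_inj _ _ _ _ _ Hp Hq).
    - intros [(p & Hp & Hpt)|[-> ->]].
      + exists p. split; [easy|]. apply Ht'. now left.
      + exists q. split; [easy|]. apply Ht'. right. apply Hq1. now left. }
  exists t'. split; [split; [|split]|split].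
  - intros p Hp. apply Ht' in Hp as [Hp|Hp].
    + destruct (proj1 Ht p Hp) as (n & y & Hn & H). exists n, y.
      split; [|easy]. apply Hs. now left.
    + assert (p = q) as -> by (apply Hq1 in Hp; tauto). exists i, x.
      split; [|easy]. apply Hs. now right.
  - intros n Hn. apply Hs in Hn as [Hn| ->].
    + destruct (proj1 (proj2 Ht) n Hn) as [y Hy]. exists y. apply Hmaps. now left.
    + exists x. apply Hmaps. now right.
  - assert (Hnew : forall y, ~ Maps t i y).
    { intros y Hy. apply (omega_irrefl w w_omega i Hi).
      now apply (PartialChoice_Maps t i i y). }
    intros n y y' Hy Hy'. apply Hmaps in Hy, Hy'.
    destruct Hy as [Hy|[-> ->]], Hy' as [Hy'|[Hn Hyx]]; subst; try easy.
    + now apply (proj2 (proj2 Ht) n).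
    + now destruct (Hnew y).
    + now destruct (Hnew y').
  - intros p Hp. apply Ht'. now left.
  - intros p Hp. apply Ht' in Hp as [Hp|Hp]; [now left|right].
    now assert (p = q) as -> by (apply Hq1 in Hp; tauto).
Qed.

Lemma PartialChoice_exists m : E m w -> exists s, PartialChoice s m.
Proof.
  revert m. apply (omega_ind w w_omega (fun m => exists s, PartialChoice s m)).
  - definable.
  - intros z Hz. exists z. now apply PartialChoice_empty.
  - intros n s Hn [t Ht] Hs. destruct (Value_exists n Hn) as [x Hx].
    destruct (PartialChoice_extend t n s x) as (t' & Ht' & _); try easy.
    now exists t'.
Qed.

Lemma PartialChoice_set_exists :
  exists Y, forall s, E s Y <-> exists m, E m w /\ PartialChoice s m.
Proof.
  destruct family_union_exists as [u Hu].
  destruct (product_bound w u) as [c Hc], (power_axiom c) as [P HP].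
  destruct (separation (fun s => exists m, E m w /\ PartialChoice s m))
    with (a := P) as [Y HY]; [definable|].
  exists Y. intros s. rewrite (HY s). split; [now intros []|].
  intros (m & Hm & Hs). split; [|eauto].
  apply HP. intros p Hp. destruct (proj1 Hs p Hp) as (n & x & Hn & Hx & Hnx).
  apply (Hc n x p); [|apply Hu; exists n; exact Hx|easy].
  now apply (omega_elem w w_omega m).
Qed.

(** A finite set of partial choices has an upper bound for the lengths of its
    members, but there are partial choices of every length. *)
Lemma PartialChoice_set_infinite Y :
  (forall s, E s Y <-> exists m, E m w /\ PartialChoice s m) -> ~ Finite Y.
Proof.
  intros HY HF.
  destruct (finite_bound Y (fun n => E n w)
    (fun s n => exists m, PartialChoice s m /\ Sub m n)) as (n & Hn & H).
  - definable.
  - definable.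
  - destruct null_set_axiom as [z Hz]. exists z. now apply omega_zero.
  - intros n n' Hn Hn'.
    destruct (omega_linear w w_omega n n' Hn Hn') as [Hs|Hs].
    + exists n'. split; [easy|].
      intros x [(m & Hm & Hmn)|H]; [|easy]. exists m. firstorder.
    + exists n. split; [easy|].
      intros x [H|(m & Hm & Hmn)]; [easy|]. exists m. firstorder.
  - easy.
  - intros s Hs. apply HY in Hs as (m & Hm & Hs). exists m. split; [easy|].
    exists m. split; [easy|]. now intros k.
  - destruct (succ_exists w w_omega n Hn) as (n' & Hn' & Hn'w).
    destruct (PartialChoice_exists n' Hn'w) as [s Hs].
    destruct (H s) as (m & Hm & Hmn); [apply HY; eauto|].
    destruct (proj1 (proj2 Hs) n) as [x Hx]; [apply Hn'; now right|].
    apply (omega_irrefl w w_omega n Hn), Hmn.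
    now apply (PartialChoice_Maps s m n x).
Qed.

(** A proper extension of a partial choice of length [i] is defined at [i],
    because domains are initial segments. *)
Lemma PartialChoice_sub t i s m : E i w -> E m w ->
  PartialChoice t i -> PartialChoice s m -> Sub t s ->
  s = t \/ exists x, Maps s i x.
Proof.
  intros Hi Hm Ht Hs Hsub.
  assert (Hmaps : forall n x, Maps t n x -> Maps s n x).
  { intros n x (p & Hp & Hpt). exists p. auto. }
  assert (Him : Sub i m).
  { intros n Hn. destruct (proj1 (proj2 Ht) n Hn) as [x Hx].
    now apply (PartialChoice_Maps s m n x), Hmaps. }
  destruct (omega_sub_cases w w_omega m Hm i Hi Him) as [->|Hin].
  - left. apply extensionality_axiom. intros p. split; [|apply Hsub].
    intros Hp. destruct (proj1 Hs p Hp) as (n & x & Hn & _ & Hnx).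
    destruct (proj1 (proj2 Ht) n Hn) as [y Hy].
    assert (x = y) as ->.
    { apply (proj2 (proj2 Hs) n); [now exists p|auto]. }
    now apply (Maps_mem t n y p Hnx).
  - right. now apply Hs.
Qed.

Section Selection.

Context (O : D -> Prop) (R : D -> D -> Prop) (OR : OmegaOrder O R).
Hypothesis O_PartialChoice :
  forall s, O s -> exists m, E m w /\ PartialChoice s m.

(** Pigeonhole principle: if cofinally many members of [O] extend [t], then,
    because only one of them is [t] and the rest fall into finitely many
    classes according to their value at [i], one of these classes is cofinal. *)
Lemma cofinal_extension t i s : E i w -> PartialChoice t i -> Succ s i ->
  (forall z, O z -> exists s, R z s /\ Sub t s) ->
  exists t', PartialChoice t' s /\ forall z, O z -> exists s, R z s /\ Sub t' s.
Proof.
  intros Hi Ht Hs Hcof.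
  assert (HO := oo_dfn_class _ _ OR). assert (HR := oo_dfn _ _ OR).
  assert (Hx : exists x, Value i x /\
    forall z, O z -> exists s, R z s /\ Sub t s /\ Maps s i x).
  { apply NNPP. intros Hn.
    destruct F_family as [(_ & Htot & HF) HX].
    destruct (Htot i Hi) as [X HiX]. destruct (HX i X HiX) as [_ HXfin].
    destruct (finite_bound X O
      (fun x z => forall s, R z s -> Sub t s -> ~ Maps s i x)) as (z & Hz & H).
    - definable.
    - definable.
    - apply (oo_inhabited _ _ OR).
    - intros z z' Hz Hz'. destruct (oo_linear _ _ OR z z' Hz Hz') as [Hzz|Hzz].
      + exists z'. split; [easy|].
        intros x [H|H] u Hu; apply H; [now apply (oo_trans _ _ OR z z')|easy].
      + exists z. split; [easy|].
        intros x [H|H] u Hu; apply H; [easy|now apply (oo_trans _ _ OR z' z)].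
    - easy.
    - intros x Hx. apply NNPP. intros Hn'. apply Hn. exists x.
      split; [now exists X|]. intros z Hz. apply NNPP. intros Hs'.
      apply Hn'. exists z. split; [easy|]. intros u Hu Htu Hux. eauto.
    (* Beyond [z] no value at [i] occurs, and beyond [z'] also [t] itself is
       excluded. *)
    - destruct (oo_unbounded _ _ OR z t Hz) as (z' & Hzz' & Hz't).
      assert (Hz' : O z') by now apply (oo_upward _ _ OR z).
      destruct (Hcof z' Hz') as (u & Hu & Htu).
      destruct (O_PartialChoice u) as (m & Hm & Hum);
        [now apply (oo_upward _ _ OR z')|].
      destruct (PartialChoice_sub t i u m) as [->|[x Hx]]; try easy.
      apply (H x) with u; try easy.
      + destruct (PartialChoice_Maps u m i x Hum Hx) as [_ (X' & HX' & HxX')].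
        now rewrite (HF i X X' HiX HX').
      + now apply (oo_trans _ _ OR z z'). }
  destruct Hx as (x & Hx & Hcofx).
  destruct (PartialChoice_extend t i s x Hi Ht Hs Hx) as (t' & Ht' & Hsub & Hnew).
  exists t'. split; [easy|]. intros z Hz.
  destruct (Hcofx z Hz) as (u & Hzu & Htu & Hux). exists u. split; [easy|].
  intros p Hp. destruct (Hnew p Hp) as [Hpt|Hpx]; [auto|].
  now apply (Maps_mem u i x p Hpx).
Qed.

Lemma cofinal_PartialChoice i : E i w ->
  exists t, PartialChoice t i /\ forall z, O z -> exists s, R z s /\ Sub t s.
Proof.
  assert (HO := oo_dfn_class _ _ OR). assert (HR := oo_dfn _ _ OR).
  revert i. apply (omega_ind w w_omega (fun i => exists t,
    PartialChoice t i /\ forall z, O z -> exists s, R z s /\ Sub t s)).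
  - definable.
  - intros z Hz. exists z. split; [now apply PartialChoice_empty|].
    intros s _. exists s. split; [apply (oo_refl _ _ OR)|].
    intros p Hp. now destruct (Hz p).
  - intros i s Hi (t & Ht & Hcof) Hs. now apply cofinal_extension with t i.
Qed.

Lemma defined_everywhere n : E n w -> exists s, O s /\ exists x, Maps s n x.
Proof.
  intros Hn. destruct (succ_exists w w_omega n Hn) as (n' & Hn' & Hn'w).
  destruct (cofinal_PartialChoice n' Hn'w) as (t & Ht & Hcof).
  destruct (oo_inhabited _ _ OR) as [z Hz], (Hcof z Hz) as (s & Hs & Hts).
  exists s. split; [now apply (oo_upward _ _ OR z)|].
  destruct (proj1 (proj2 Ht) n) as (x & p & Hp & Hpt); [apply Hn'; now right|].
  exists x, p. auto.
Qed.

(** The value at [n] is read off from the first member of [O] that is defined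
    at [n]. *)
Lemma choice_exists : exists f, Choice f F w.
Proof.
  assert (HO := oo_dfn_class _ _ OR). assert (HR := oo_dfn _ _ OR).
  destruct family_union_exists as [u Hu].
  destruct (relation_exists (fun n x => exists s,
    (O s /\ forall t, O t -> (exists y, Maps t n y) -> R s t) /\ Maps s n x))
    with (a := w) (b := u) as (f & Hf & Hmaps); [definable|].
  assert (Hval : forall s n x, O s -> Maps s n x -> Value n x).
  { intros s n x Hs Hx. destruct (O_PartialChoice s Hs) as (m & _ & Hm).
    now apply (PartialChoice_Maps s m). }
  assert (Htot : forall n, E n w -> exists x, Maps f n x).
  { intros n Hn. destruct (defined_everywhere n Hn) as (t & Ht & Htn).
    destruct (oo_least _ _ OR (fun t => exists x, Maps t n x)) with (t := t)
      as (s & Hs & (x & Hx) & Hleast); [definable|easy|easy|].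
    exists x. apply Hmaps. split; [easy|]. split; [|now exists s].
    apply Hu. exists n. now apply Hval with s. }
  exists f. split.
  - exists u. split; [easy|]. split; [split; [easy|split]|].
    + easy.
    + intros n x y Hx Hy. apply Hmaps in Hx, Hy.
      destruct Hx as (_ & _ & s & [Hs Hmin] & Hx).
      destruct Hy as (_ & _ & s' & [Hs' Hmin'] & Hy).
      assert (s = s') as <-.
      { apply (oo_antisym _ _ OR); eauto. }
      destruct (O_PartialChoice s Hs) as (m & _ & Hm).
      now apply (proj2 (proj2 Hm) n).
    + intros n x Hx. now apply Hmaps in Hx.
  - intros n Hn. destruct (Htot n Hn) as [x Hx].
    assert (Hx' := Hx). apply Hmaps in Hx as (_ & _ & s & [Hs _] & Hx).
    destruct (Hval s n x Hs Hx) as (X & HX & HxX). now exists X, x.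
Qed.

End Selection.

Lemma countable_choice : exists f, Choice f F w.
Proof.
  destruct PartialChoice_set_exists as [Y HY].
  destruct (DedekindInfinite_order Y) as (O & R & OR & HOY).
  - now apply SD_holds, PartialChoice_set_infinite.
  - apply (choice_exists O R OR). intros s Hs. now apply HY, HOY.
Qed.

End CountableChoice.

End Structure.

(** * Derivability from Z and SD *)

Lemma bounded_alls n p m : bounded (n + m) p -> bounded m (alls n p).
Proof.
  revert m. induction n as [|n IH]; simpl; intros m H; [easy|].
  apply IH. now rewrite Nat.add_succ_r.
Qed.

Lemma Z_SD_closed q : extend Z SD q -> bounded 0 q.
Proof.
  intros [H| ->]; [destruct H|];
    try solve [cbv -[Nat.lt lt]; repeat split; lia].
  apply bounded_alls. cbn -[Nat.add]. rewrite Nat.add_0_r.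
  assert (Hr : bounded (S (S (S n)))
    (rename (fun k => match k with 0 => 0 | S k => 3 + k end) p)).
  { apply bounded_rename with (S n); [easy|]. intros [|k] Hk; lia. }
  repeat split; try lia; exact Hr.
Qed.

Theorem theorem3p6 : extend Z SD ⊢ AC_countable_fin.
Proof.
  apply completeness.
  - exact Z_SD_closed.
  - cbv -[lt]. repeat split; lia.
  - intros D E H e. apply sat_AC_countable_fin. intros w Hw F HF.
    assert (HZ : forall q, Z q -> sat E e q) by (intros q Hq; apply H; now left).
    apply countable_choice; try easy.
    + apply (sat_null_set E e), HZ, Z_null_set.
    + intros n p Hp e'. apply H. left. now apply Z_comprehension.
    + apply (sat_extensionality E e), HZ, Z_extensionality.
    + apply (sat_pair_set E e), HZ, Z_pair_set.
    + apply (sat_union_set E e), HZ, Z_union_set.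
    + apply (sat_power_set E e), HZ, Z_power_set.
    + apply (sat_SD E e), H. now right.
Qed.
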